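(* Let $n=2^{t}k$ with integers $t>2$ and $k\ge 1$, and let $S\subseteq\{1,2,\dots,n-1\}$. Let $\{1,2,\dots,n-1\}=\bigsqcup_{i}M_i$ be the partition associated with $n$ and the field $\mathbb{Q}(i)$ (defined in the context). Then the circulant digraph $D(\mathbb{Z}_n,S)$ is Gauss integral if and only if $S$ is a union of some of the sets $M_i$ (the empty union being allowed).
   Context: Let $\zeta_m=e^{2\pi i/m}$ for $m\ge1$. For $S\subseteq\{1,\dots,n-1\}$, viewed as a set of nonzero residues modulo $n$, the circulant digraph $D(\mathbb{Z}_n,S)$ is the directed graph with vertex set $\mathbb{Z}/n\mathbb{Z}$ in which there is an arc from $g_1$ to $g_2$ if and only if $g_2-g_1\in S$. Its eigenvalues are those of its adjacency matrix, namely $\lambda_r=\sum_{s\in S}\zeta_n^{rs}$ for $0\le r\le n-1$. It is called Gauss integral if all its eigenvalues are Gaussian integers, i.e. algebraic integers lying in $\mathbb{Q}(i)$. Partition associated with $n$ and $\mathbb{Q}(i)$: let $d(n)$ be the set of positive divisors $p$ of $n$ with $p<n$ ($p$ need not be prime). Let $F=\mathbb{Q}(i)\cap\mathbb{Q}(\zeta_n)$. For $p\in d(n)$ put $g=n/p$ and $G_n(p)=\{x:1\le x<n,\ \gcd(x,n)=p\}=p\cdot(\mathbb{Z}/g\mathbb{Z})^{*}$. Let $G'_p=\mathrm{Gal}(\mathbb{Q}(\zeta_g)/F\cap\mathbb{Q}(\zeta_g))$. Each $\sigma\in G'_p$ satisfies $\sigma(\zeta_g)=\zeta_g^{a}$ for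 a unique $a=a(\sigma)\in(\mathbb{Z}/g\mathbb{Z})^{*}$, and $G'_p$ acts on $G_n(p)$ by $\sigma\cdot(px')=p\,(a(\sigma)x'\bmod g)$, with residues modulo $g$ represented in $\{1,\dots,g-1\}$. Since $\{1,\dots,n-1\}=\bigsqcup_{p\in d(n)}G_n(p)$, the orbits of all these actions, over all $p\in d(n)$, form a partition of $\{1,\dots,n-1\}$; these orbits are the sets $M_i$. *)

(* Defs.v *)
From HB Require Import structures.
From mathcomp Require Import all_boot all_order all_algebra all_field.

Set Implicit Arguments.
Unset Strict Implicit.
Unset Printing Implicit Defensive.

Import Order.TTheory GRing.Theory Num.Theory.
Local Open Scope ring_scope.

(* This is e^(2 i pi / m): for m > 1, m.-root (-1) is the m-th root of -1     *)
(* with least nonnegative argument, i.e. e^(i pi / m) (see rootC_Re_max and   *)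
(* Im_rootC_ge0), and 1.-root (-1) = -1 = e^(i pi).                           *)
Definition zeta (m : nat) : algC := m.-root (-1) ^+ 2.

Section Circulant.

Variable n : nat.
Implicit Type S : {set 'I_n}.

(* g2 - g1 \in S, where g1, g2 and the elements of S stand for their residue  *)
(* classes modulo n.                                                          *)
Definition circ_arc S (g1 g2 : 'I_n) : bool :=
  [exists s in S, (g2 == g1 + s %[mod n])%N].

Definition circ_adj S : 'M[algC]_n :=
  \matrix_(g1, g2) (circ_arc S g1 g2)%:R.

(* Crat_span [:: 1; 'i] is Q(i).                                              *)
Definition gaussian_integer (x : algC) : bool :=
  (x \in Aint) && (x \in Crat_span [:: 1; 'i]).

Definition gauss_integral S : Prop :=
  forall a : algC, eigenvalue (circ_adj S) a -> gaussian_integer a.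

End Circulant.

(* The subfields Q(i) and Q(zeta g), g %| n, and the Galois groups between    *)
(* them are taken inside a number field that is normal over Q and contains    *)
(* the 4n-th roots of unity, hence 'i and zeta n; the Galois groups and the   *)
(* partition below do not depend on its choice.                               *)
Fact cyc_subproof n :
  {L : splittingFieldType rat & {LC : {rmorphism L -> algC} |
     (0 < n)%N -> forall x : algC, x ^+ (4 * n) = 1 -> exists y, LC y = x}}.
Proof.
pose N := (4 * n.-1.+1)%N; have N_gt0: (0 < N)%N by [].
have [z prim_z] := C_prim_root_exists N_gt0.
have [Qn [QnC [[|zn []] // [Dz]] genQn]] := num_field_exists [:: z].
have prim_zn: N.-primitive_root zn by rewrite -(fmorph_primitive_root QnC) Dz.
have splitQn: SplittingField.axiom Qn.
  exists ('X^N - 1); first by rewrite rpredB ?rpred1 ?rpredX ?polyOverX.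
  exists [seq zn ^+ k | k <- index_iota 0 N].
    by rewrite -(factor_Xn_sub_1 prim_zn) big_map eqpxx.
  apply/eqP; rewrite eqEsubv subvf -genQn; apply/adjoin_seqSr => y.
  rewrite mem_seq1 => /eqP->; apply/mapP; exists 1%N => //.
  by rewrite mem_index_iota /N mulnS.
pose Ln : splittingFieldType rat :=
  HB.pack (FieldExt.sort Qn) (FieldExt_isSplittingField.Build rat Qn splitQn).
exists Ln, QnC => n_gt0 x; rewrite -(prednK n_gt0) -/N => /(prim_rootP prim_z).
by case=> i ->; exists (zn ^+ i); rewrite rmorphXn /= Dz.
Qed.

Section Partition.

Variable n : nat.

Definition cycL : splittingFieldType rat := projT1 (cyc_subproof n).

Definition cycC : {rmorphism cycL -> algC} := sval (projT2 (cyc_subproof n)).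

Definition toL : algC -> cycL := s2val (num_field_proj cycC).

Lemma cycLP (x : algC) : (0 < n)%N -> x ^+ (4 * n) = 1 -> cycC (toL x) = x.
Proof.
move=> n_gt0 x1; have [y <-] := svalP (projT2 (cyc_subproof n)) n_gt0 x x1.
by congr (cycC _); exact: (s2valP' (num_field_proj cycC)).
Qed.

Definition Qi : {subfield cycL} := <<1; toL 'i>>%AS.

Definition Qzeta (m : nat) : {subfield cycL} := <<1; toL (zeta m)>>%AS.

Definition fieldF : {subfield cycL} := (Qi :&: Qzeta n)%AS.

Definition galG (p : nat) : {set gal_of (Qzeta (n %/ p))} :=
  'Gal(Qzeta (n %/ p) / fieldF :&: Qzeta (n %/ p))%g.

(* The exponent a modulo g = n / p with sigma (zeta g) = zeta g ^+ a. The     *)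
(* default 0 is never used when p %| n and 0 < p < n.                         *)
Definition galexp (p : nat) (sigma : gal_of (Qzeta (n %/ p))) : nat :=
  let g := (n %/ p)%N in let z := toL (zeta g) in
  oapp val 0%N [pick a : 'I_g | coprime a g & sigma z == z ^+ a].

(* sigma sends p x' to p (a x' mod g), where x' = x / p is exact when         *)
(* gcdn x n = p.                                                              *)
Definition galact (p : nat) (sigma : gal_of (Qzeta (n %/ p))) (x : nat) : nat :=
  (p * ((galexp sigma * (x %/ p)) %% (n %/ p)))%N.

Definition galorbit (p x : nat) : {set 'I_n} :=
  [set y : 'I_n | [exists sigma in galG p, val y == galact sigma x]].

(* p > 0 is automatic: 0 %| n only if n = 0, and 'I_0 is empty.               *)
Definition dset : {set 'I_n} := [set p : 'I_n | (p %| n)%N].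

Definition Gset (p : nat) : {set 'I_n} :=
  [set x : 'I_n | (0 < x)%N && (gcdn x n == p)].

(* The orbits of the actions above, over all p in dset.                       *)
Definition Mset : {set {set 'I_n}} :=
  [set galorbit (val p) (val x) | p in dset, x in Gset (val p)].

End Partition.

(* Main.v *)
Require Import Defs.
From mathcomp Require Import all_boot all_order all_algebra all_field.
From mathcomp Require Import all_fingroup ring.

(** The eigenvalues of the circulant digraph are the values of the discrete
Fourier transform of the indicator function of S, namely the sums l_r of
zeta ^ (r s) over s in S ([eigenvalue_circP]).  They are always algebraic
integers, so the digraph is Gauss integral exactly when every l_r lies in Q(i).

By Galois theory this means that every tau in Gal(L / Q(i)) fixes every l_r,
where L is the ambient normal number field.  Such a tau raises the n-th roots of
unity to some power a prime to n, so it sends l_r to the r-th Fourier coefficient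
of the indicator of a S.  Since the Fourier transform is injective
([fourier_inj]), Gauss integrality amounts to a S = S for all exponents a arising
from Gal(L / Q(i)) ([gauss_integral_stableP]).

These exponents form a group modulo n, so the stable sets are the unions of its
orbits, and it remains to see that the sets of the partition are the orbits of
multiplication by these exponents ([galorbitP]).  With g = n / p and
E = Q(zeta_g), restriction to E maps Gal(L / Q(i)) onto Gal(E / Q(i) :&: E)
([gal_restrict], [gal_extend]), the group acting on the residues whose gcd with
n is p; and multiplying x = p x' by a modulo n is the same as multiplying x' by a
modulo g.

All this needs zeta_m, defined through the principal m-th root of -1, to be a
primitive m-th root of unity ([zeta_prim]); a geometric extremality argument
gives it ([rootCN1_prim]). *)

(** * The principal root of -1 generates the roots of unity *)

Section RootsOfUnity.

Set Implicit Arguments.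
Unset Strict Implicit.
Import Order.TTheory GRing.Theory Num.Theory.
Local Open Scope ring_scope.

(** Write theta and phi for the arguments of w and u, so that
0 < theta < phi <= pi.  Turning u back by 2 theta gives argument phi - 2 theta,
which has absolute value less than phi.  Algebraically, the gain in real part is
2 sin(theta) sin(phi - theta), and sin(phi - theta) is positive because
  sin(phi - theta) (sin theta + sin phi)
    = (cos theta - cos phi) (1 + cos(phi - theta)).
Below, x, y are the coordinates of u and c, s those of w. *)
Lemma unit_turn_back (C : numClosedFieldType) (u w : C) :
    `|u| = 1 -> `|w| = 1 -> w ^+ 2 != 1 -> 0 <= 'Im u -> 0 <= 'Im w ->
  'Re u < 'Re w -> 'Re u < 'Re (u / w ^+ 2).
Proof.
move=> u1 w1 w2 y0 s0 ltxc.
have Dw: w^-1 = w^* by rewrite invC_norm w1 expr1n invr1 mul1r.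
have := normC2_Re_Im u; have := normC2_Re_Im w.
rewrite u1 w1 expr1n -exprVn Dw => Ew Eu.
have Du := Crect u; have := Crect w.
move: ('Re u) ('Im u) ('Re w) ('Im w) (Creal_Re u) (Creal_Im u) (Creal_Re w)
  (Creal_Im w) => x y c s Rx Ry Rc Rs in y0 s0 ltxc Eu Ew Du * => Dw'.
have s_gt0: 0 < s.
  rewrite lt_def s0 andbT; apply: contraNneq w2 => s_0.
  by rewrite Dw' s_0 mulr0 addr0 Ew s_0 expr0n addr0.
have -> : 'Re (u * w^* ^+ 2) = x * (c ^+ 2 - s ^+ 2) + 2 * (y * c * s).
  rewrite Dw' Du rmorphD rmorphM /= conjCi (conj_Creal Rc) (conj_Creal Rs).
  transitivity ('Re (x * (c ^+ 2 - s ^+ 2) + 2 * (y * c * s)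
                     + 'i * (y * (c ^+ 2 - s ^+ 2) - 2 * (x * c * s)))).
    congr ('Re _); transitivity ((x + 'i * y) * (c ^+ 2 + ('i ^+ 2) * s ^+ 2
       - 2 * 'i * (c * s))); first by ring.
    rewrite sqrCi; transitivity (x * (c ^+ 2 - s ^+ 2) - 2 * 'i ^+ 2 * (y * c * s)
                     + 'i * (y * (c ^+ 2 - s ^+ 2) - 2 * (x * c * s))).
      by ring.
    by rewrite sqrCi; ring.
  by rewrite Re_rect // !(rpredB, rpredD, rpredM, rpredX, rpred1).
have E_gt0 : 0 < 1 + (x * c + y * s).
  (* This is |u + w|^2 / 2, and u + w has positive imaginary part. *)
  have -> : 1 + (x * c + y * s) = ((x + c) ^+ 2 + (y + s) ^+ 2) / 2.
    transitivity ((1 + 1 + 2 * (x * c + y * s)) / 2 : C); first by field.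
    by rewrite {1}Eu {1}Ew; field.
  rewrite divr_gt0 ?ltr0n // ltr_wpDl ?exprn_gt0 ?ltr_wpDl //.
  by rewrite real_exprn_even_ge0 ?rpredD.
have D_gt0: 0 < y * c - x * s.
  have: 0 < (y * c - x * s) * (s + y).
    suff -> : (y * c - x * s) * (s + y) = (c - x) * (1 + (x * c + y * s)).
      by rewrite mulr_gt0 ?subr_gt0.
    transitivity (c * (x ^+ 2 + y ^+ 2) - x * (c ^+ 2 + s ^+ 2)
       + (c - x) * (x * c + y * s)); first by ring.
    by rewrite -Eu -Ew; ring.
  by rewrite pmulr_lgt0 // ltr_wpDr.
rewrite -subr_gt0.
have -> : x * (c ^+ 2 - s ^+ 2) + 2 * (y * c * s) - x = 2 * s * (y * c - x * s).
  by rewrite -[X in _ - X]mulr1 [X in _ - x * X]Ew; ring.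
by rewrite !mulr_gt0 ?ltr0n.
Qed.

(** Let d be the order of w = m.-root (-1), and suppose that it is a proper
divisor of 2 m.  Some m-th root of -1 then lies outside the group generated by w,
that is, has its d-th power different from 1.  Take such a root u of maximal real
part, in the upper half plane.  By definition w has the largest real part of
all the m-th roots of -1 there, so u / w ^+ 2, which is another m-th root of -1
outside that group, has a larger real part than u: a contradiction. *)
Lemma rootCN1_prim m : (1 < m)%N -> (2 * m).-primitive_root (m.-root (-1) : algC).
Proof.
move=> m_gt1; have m_gt0 := ltnW m_gt1.
have N_gt1: (1 < 2 * m)%N by rewrite mul2n -addnn ltn_addr.
set w := m.-root (-1); have wm: w ^+ m = -1 by rewrite rootCK.
have N1neq1: (-1 : algC) != 1 by rewrite eqNr oner_eq0.
have wN: w ^+ (2 * m) = 1 by rewrite mulnC exprM wm sqrrN expr1n.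
have [d prim_w d_dv] := prim_order_exists (ltnW N_gt1) wN.
have [v prim_v] := C_prim_root_exists (ltnW N_gt1).
have vm: v ^+ m = -1.
  have /eqP: (v ^+ m) ^+ 2 = 1 by rewrite -exprM mulnC prim_expr_order.
  rewrite sqrf_eq1 => /orP[|/eqP//]; rewrite -(prim_order_dvd prim_v).
  by rewrite gtnNdvd // mul2n -addnn -[ltnLHS]addn0 ltn_add2l.
have [vd|vd] := eqVneq (v ^+ d) 1.
  suff <- : d = (2 * m)%N by [].
  by apply/eqP; rewrite eqn_dvd d_dv (prim_order_dvd prim_v) vd eqxx.
pose U := [pred i : 'I_(2 * m) | ((v ^+ i) ^+ m == -1) && ((v ^+ i) ^+ d != 1)].
have U1: U (Ordinal N_gt1) by rewrite /= !expr1 vm eqxx.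
have ReR (i : 'I_(2 * m)) : U i -> 'Re (v ^+ i) \is Num.real.
  by move=> _; apply: Creal_Re.
have [i /andP[/eqP um ud] max_i] := real_arg_maxP U1 ReR.
have maxU x : x ^+ m = -1 -> x ^+ d != 1 -> 'Re x <= 'Re (v ^+ i).
  move=> xm xd.
  have [|j Dx] := prim_rootP prim_v (x := x).
    by rewrite mulnC exprM xm sqrrN expr1n.
  by rewrite Dx; apply: max_i; rewrite /U /= -Dx xm eqxx.
have norm1 (x : algC) : x ^+ m = -1 -> `|x| = 1.
  move=> xm; apply/eqP; rewrite -(@pexpr_eq1 _ _ m) // -normrX xm.
  by rewrite normrN normr1.
have [u [{}um {}ud {}maxU Iu]]: exists u : algC, [/\ u ^+ m = -1, u ^+ d != 1,
    forall x, x ^+ m = -1 -> x ^+ d != 1 -> 'Re x <= 'Re u & 0 <= 'Im u].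
  have [I0|I0] := boolP (0 <= 'Im (v ^+ i)); first by exists (v ^+ i).
  exists (v ^+ i)^*; split; rewrite -?rmorphXn /= ?um ?rmorphN1 ?fmorph_eq1 //.
    by move=> x; rewrite Re_conj; apply: maxU.
  by rewrite Im_conj oppr_ge0 ltW // real_ltNge ?Creal_Im.
have Iw: 0 <= 'Im w by apply: Im_rootC_ge0.
have leuw: 'Re u <= 'Re w by apply: rootC_Re_max.
have ltuw: 'Re u < 'Re w.
  rewrite lt_neqAle leuw andbT; apply: contraNneq ud => eqRe.
  suff -> : u = w by rewrite prim_expr_order.
  rewrite [u]Crect [w]Crect eqRe; congr (_ + 'i * _); apply/eqP.
  rewrite -(@eqrXn2 _ 2) //; apply/eqP/(addrI ('Re u ^+ 2)).
  by rewrite {2}eqRe -!normC2_Re_Im !norm1.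
have w2: w ^+ 2 != 1.
  apply/eqP=> w2; have := ltuw.
  have: w == 1 \/ w == -1 by apply/orP; rewrite -sqrf_eq1 w2.
  case=> /eqP Dw; first by have := wm; rewrite Dw expr1n => /esym/eqP/idPn[].
  rewrite Dw (Creal_ReP (-1) _) ?rpredN1 // => /lt_geF.
  by rewrite lerNl -raddfN /= -(norm1 _ um) -normrN leif_Re_Creal.
have /negP[] : ~~ ('Re (u / w ^+ 2) <= 'Re u).
  by rewrite -real_ltNge ?Creal_Re // unit_turn_back ?norm1.
apply: maxU; rewrite expr_div_n -exprM mulnC.
  by rewrite exprM wm sqrrN expr1n divr1.
by rewrite exprM (prim_expr_order prim_w) expr1n divr1.
Qed.

Lemma zeta_prim m : (1 < m)%N -> m.-primitive_root (zeta m).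
Proof.
move=> m_gt1; have := dvdn_prim_root (rootCN1_prim m_gt1) (dvdn_mull 2 (dvdnn m)).
by rewrite mulnK // ltnW.
Qed.

End RootsOfUnity.

(** * The spectrum of a circulant digraph *)

Section CirculantSpectrum.

Set Implicit Arguments.
Unset Strict Implicit.
Import Order.TTheory GRing.Theory Num.Theory.
Local Open Scope ring_scope.

(** The sums are the values at the n distinct powers of z of the polynomial
with coefficients f, whose degree is less than n. *)
Lemma fourier_inj (F : fieldType) (n : nat) (z : F) (f : 'I_n -> F) :
    n.-primitive_root z ->
    (forall r : 'I_n, \sum_(j < n) f j * z ^+ (r * j) = 0) ->
  forall j, f j = 0.
Proof.
move=> prim_z f0 j; pose p := \sum_(i < n) f i *: 'X^i.
suff p0: p = 0.
  have := congr1 (fun q : {poly F} => q`_j) p0; rewrite coef0 => <-.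
  rewrite coef_sum (bigD1 j) //= coefZ coefXn eqxx mulr1 big1 ?addr0 // => i nij.
  by rewrite coefZ coefXn eq_sym (inj_eq val_inj) (negPf nij) mulr0.
pose rs := [seq z ^+ i | i <- iota 0 n].
have sz_p: (size p <= n)%N.
  apply: leq_trans (size_sum _ _ _) _; apply/bigmax_leqP => i _.
  by apply: leq_trans (size_scale_leq _ _) _; rewrite size_polyXn.
have root_p: all (root p) rs.
  apply/allP=> x /mapP[i]; rewrite mem_iota => /= lt_in ->{x}.
  rewrite /root horner_sum; apply/eqP; rewrite -[RHS](f0 (Ordinal lt_in)).
  by apply: eq_bigr => h _; rewrite hornerZ hornerXn exprM.
have uniq_rs: uniq rs.
  rewrite map_inj_in_uniq ?iota_uniq // => i h; rewrite !mem_iota /= => lti lth.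
  by move/eqP; rewrite (eq_prim_root_expr prim_z) !modn_small // => /eqP.
apply/eqP; apply: contraLR sz_p => nz_p; rewrite -ltnNge.
by have := max_poly_roots nz_p root_p uniq_rs; rewrite size_map size_iota.
Qed.

(** The character g |-> z ^ (- r g) is a row eigenvector for the r-th sum.
Conversely, pairing a row eigenvector v with the characters turns the adjacency
matrix into multiplication by these sums, and some pairing is nonzero by
injectivity of the Fourier transform. *)
Lemma eigenvalue_circP (n : nat) (z : algC) (S : {set 'I_n}) (a : algC) :
    n.-primitive_root z ->
  eigenvalue (circ_adj S) a <-> exists r : 'I_n, a = \sum_(s in S) z ^+ (r * s).
Proof.
case: n S => [|n] S prim_z; first by have := prim_order_gt0 prim_z.
pose chi (r g : 'I_n.+1) := z ^+ (r * g).
have chiD r g h : chi r (g + h) = chi r g * chi r h.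
  by rewrite /chi /= -exprD -mulnDr !(mulnC r) !exprM (prim_expr_mod prim_z).
have adjE g h : circ_adj S g h = (h - g \in S)%:R.
  rewrite mxE; congr (nat_of_bool _)%:R; apply/exists_inP/idP.
    move=> [s Ss /eqP Dh]; suff -> : h = g + s by rewrite addrC addKr.
    by apply/val_inj; rewrite /= -Dh modn_small.
  by move=> Shg; exists (h - g) => //=; rewrite -{1}(subrK g h) addrC /= modn_mod.
have lamE (r : 'I_n.+1) : \sum_(s in S) z ^+ (r * s) = \sum_s (s \in S)%:R * chi r s.
  by rewrite big_mkcond; apply: eq_bigr => s _; case: (s \in S); rewrite ?mul1r ?mul0r.
split.
  case/eigenvalueP=> v vA nz_v; pose f r := \sum_h v 0 h * chi r h.
  have [r fr|f0] := pickP (fun r => f r != 0); last first.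
    case/eqP: nz_v; apply/rowP=> h; rewrite mxE.
    by apply: (fourier_inj (f := v 0) prim_z) => r; apply/eqP/negPn; rewrite -/(f r) f0.
  exists r; apply: (mulIf fr); rewrite {1}/f mulr_sumr lamE.
  transitivity (\sum_h \sum_g v 0 g * (h - g \in S)%:R * chi r h).
    apply: eq_bigr => h _; have /rowP/(_ h) := vA; rewrite !mxE mulrA => <-.
    by rewrite mulr_suml; apply: eq_bigr => g _; rewrite adjE.
  rewrite exchange_big /= /f mulr_sumr; apply: eq_bigr => g _.
  rewrite mulrCA mulr_suml mulr_sumr (reindex_inj (addIr g)) /=.
  apply: eq_bigr => s _; rewrite addrK chiD; ring.
case=> r ->; apply/eigenvalueP; exists (\row_g chi r (- g)).
  apply/rowP=> h; rewrite !mxE lamE mulr_suml (reindex_inj (subrI h)) /=.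
  apply: eq_bigr => s _; rewrite adjE subKr mxE opprB chiD; ring.
apply/eqP=> /rowP/(_ 0); rewrite !mxE oppr0 /chi muln0 expr0 => /eqP.
by rewrite oner_eq0.
Qed.

Lemma gauss_integralP (n : nat) (z : algC) (S : {set 'I_n}) :
    n.-primitive_root z ->
  gauss_integral S <->
  forall r : 'I_n, \sum_(s in S) z ^+ (r * s) \in Crat_span [:: 1; 'i].
Proof.
move=> prim_z; split=> [intS r | CratS a /(eigenvalue_circP _ _ prim_z)[r ->]].
  have /intS/andP[] // : eigenvalue (circ_adj S) (\sum_(s in S) z ^+ (r * s)).
  by apply/(eigenvalue_circP _ _ prim_z); exists r.
rewrite /gaussian_integer CratS andbT rpred_sum // => s _.
by rewrite rpredX // (Aint_prim_root prim_z).
Qed.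

End CirculantSpectrum.

(** * Fields of definition and restriction of automorphisms *)

Section GaloisTheory.

Set Implicit Arguments.
Unset Strict Implicit.
Import Order.TTheory GRing.Theory Num.Theory.
Local Open Scope ring_scope.

(** A polynomial in j over Q reduces modulo 'X^2 + 1 to degree at most 1. *)
Lemma mem_adjoin_i (L : fieldExtType rat) (LC : {rmorphism L -> algC}) (j x : L) :
  LC j = 'i -> (x \in <<1; j>>%VS) = (LC x \in Crat_span [:: 1; 'i]).
Proof.
move=> Dj; apply/idP/Crat_spanP => [/Fadjoin_polyP[p Qp ->] | [a Dx]].
  have j2 : j ^+ 2 = -1.
    by apply: (fmorph_inj LC); rewrite rmorphXn /= Dj sqrCi rmorphN1.
  pose q := p %% ('X^2 + 1).
  have D2: ('X^2 + 1 : {poly L}) \is a polyOver 1%VS.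
    by rewrite rpredD ?rpred1 ?rpredX ?polyOverX.
  have szD : size ('X^2 + 1 : {poly L}) = 3%N.
    by rewrite size_polyDl size_polyXn // size_poly1.
  have Dp: p.[j] = q.[j].
    rewrite {1}(divp_eq p ('X^2 + 1)) hornerD hornerM !hornerE j2.
    by rewrite addNr mulr0 add0r.
  have sz_q: (size q <= 2)%N.
    by rewrite -ltnS -szD ltn_modp -size_poly_eq0 szD.
  have Qq: q \is a polyOver 1%VS by rewrite modp_polyOver.
  have /vlineP[b Db] := polyOverP Qq 0%N.
  have /vlineP[c Dc] := polyOverP Qq 1%N.
  exists [ffun i => if val i == 0%N then b else c].
  rewrite Dp (horner_coef_wide _ sz_q) !big_ord_recl !big_ord0 !addr0 !ffunE /=.
  by rewrite Db Dc !expr0 !expr1 rmorphD !rmorphM /= !rmorphZ_num !rmorph1 Dj !mulr1.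
have ->: x = a 0 *: 1 + a 1 *: j.
  apply: (fmorph_inj LC); rewrite Dx !big_ord_recl big_ord0 addr0 /=.
  rewrite rmorphD /= !rmorphZ_num rmorph1 Dj.
  by congr (_ + _ * _); congr (ratr (a _)); apply/val_inj.
by rewrite rpredD // rpredZ ?rpred1 // memv_adjoin.
Qed.

Lemma ratExt_galois (L : splittingFieldType rat) (K : {subfield L}) :
  galois K {:L}.
Proof.
rewrite /galois subvf normalFieldf andbT /=.
by apply/separableP=> x _; apply/pcharf0_separable => p; rewrite pchar_lalg pchar_num.
Qed.

(** The field is the splitting field of 'X^g - 1. *)
Lemma prim_root_normal (F : fieldType) (L : splittingFieldType F) (z : L) (g : nat) :
  g.-primitive_root z -> normalField 1 <<1; z>>%AS.
Proof.
move=> prim_z; apply/splitting_normalField; first exact: sub1v.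
exists ('X^g - 1); first by rewrite rpredB ?rpred1 ?rpredX ?polyOverX.
exists [seq z ^+ k | k <- index_iota 0 g].
  by rewrite -(factor_Xn_sub_1 prim_z) big_map eqpxx.
apply/eqP; rewrite eqEsubv; apply/andP; split.
  apply/Fadjoin_seqP; split=> [|_ /mapP[k _ ->]]; first exact: sub1v.
  by rewrite rpredX // memv_adjoin.
rewrite sub_adjoin1v.
have [g_gt1|] := ltnP 1 g.
  (* z is the power of exponent 1, listed only if g > 1. *)
  by apply: seqv_sub_adjoin; apply/mapP; exists 1%N; rewrite ?mem_index_iota.
have := prim_order_gt0 prim_z; case: g prim_z => [|[]] // prim_z _ _.
by have := prim_expr_order prim_z; rewrite expr1 => ->; apply: rpred1.
Qed.

Section Restriction.

Variables (F : fieldType) (L : splittingFieldType F) (K E : {subfield L}).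
Hypotheses (galL : galois 1 {:L}) (nE : normalField 1 E).

Lemma gal_restrict (tau : gal_of {:L}) : tau \in 'Gal({:L} / K)%g ->
  exists2 sigma, sigma \in 'Gal(E / K :&: E)%g & {in E, sigma =1 tau}.
Proof.
have sE : (1 <= E <= {:L})%VS by rewrite sub1v subvf.
move=> Ktau; have tau1 := subsetP (galS _ (sub1v K)) tau Ktau.
exists (normalField_cast E tau) => [|a Ea]; last exact: normalField_cast_eq sE nE _ tau1 _ Ea.
rewrite gal_kHom ?capvSr //; apply/kAHomP=> a /memv_capP[Ka Ea].
by rewrite (normalField_cast_eq sE nE tau1 Ea) (fixed_gal (subvf K)).
Qed.

(** Let H be the image of the restriction map.  An element of E fixed by H is
fixed by Gal(L / K), hence lies in K.  So the fixed field of H is contained in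
K :&: E, and H is all of Gal(E / K :&: E) by the Galois correspondence. *)
Lemma gal_extend (sigma : gal_of E) : sigma \in 'Gal(E / K :&: E)%g ->
  exists2 tau, tau \in 'Gal({:L} / K)%g & {in E, sigma =1 tau}.
Proof.
have sE : (1 <= E <= {:L})%VS by rewrite sub1v subvf.
have sKG : 'Gal({:L} / K)%g \subset 'Gal({:L} / 1)%g := galS _ (sub1v K).
pose H := (normalField_cast_morphism sE nE @* 'Gal({:L} / K))%G.
have sHK : (fixedField H <= K :&: E)%VS.
  apply/subvP=> a /mem_fixedFieldP[Ea fixa]; rewrite memv_cap Ea andbT.
  have /galois_fixedField <- : galois K {:L}.
    by apply: galoisS galL; rewrite sub1v subvf.
  apply/fixedFieldP=> [|tau Ktau]; first exact: memvf.
  have tau1 := subsetP sKG tau Ktau.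
  by rewrite -(normalField_cast_eq sE nE tau1 Ea) fixa // mem_morphim.
move/(subsetP (galS E sHK)); rewrite gal_fixedField => /morphimP[tau tau1 Ktau ->].
by exists tau => // a Ea; rewrite -(normalField_cast_eq sE nE tau1 Ea).
Qed.

End Restriction.
End GaloisTheory.

(** * The partition as the orbits of the Galois exponents *)

Section Partition.

Set Implicit Arguments.
Unset Strict Implicit.
Import Order.TTheory GRing.Theory Num.Theory.
Local Open Scope ring_scope.

Variable n : nat.
Hypothesis n_gt1 : (1 < n)%N.

Let n_gt0 : (0 < n)%N := ltnW n_gt1.

Lemma cycC_zeta g : (1 < g)%N -> (g %| n)%N -> cycC n (toL n (zeta g)) = zeta g.
Proof.
move=> g_gt1 g_dv; apply: cycLP => //.
by apply/eqP; rewrite -(prim_order_dvd (zeta_prim g_gt1)) dvdn_mull.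
Qed.

Lemma toL_zeta_prim g :
  (1 < g)%N -> (g %| n)%N -> g.-primitive_root (toL n (zeta g)).
Proof.
by move=> *; rewrite -(fmorph_primitive_root (cycC n)) cycC_zeta // zeta_prim.
Qed.

Lemma cycC_i : cycC n (toL n 'i) = 'i.
Proof.
apply: cycLP => //; apply/eqP; rewrite exprM.
by rewrite [X in X ^+ n](exprM 'i 2 2) sqrCi sqrrN !expr1n.
Qed.

(** The exponents through which Gal(L / Q(i)) acts on the n-th roots of unity;
modulo n they form the image of Gal(Q(zeta_n) / F) in the units. *)
Definition Qi_exponent (a : nat) : Prop :=
  exists2 tau : gal_of {:cycL n}, tau \in 'Gal({:cycL n} / Qi n)%g
    & tau (toL n (zeta n)) = toL n (zeta n) ^+ a.

Let w := toL n (zeta n).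
Let prim_w : n.-primitive_root w := toL_zeta_prim n_gt1 (dvdnn n).

Lemma Qi_exponent_gal (tau : gal_of {:cycL n}) :
  tau \in 'Gal({:cycL n} / Qi n)%g -> {a | Qi_exponent a & tau w = w ^+ a}.
Proof.
move=> Ktau; have [a _ tau_w] := aut_prim_rootP tau prim_w.
by exists a => //; exists tau.
Qed.

Lemma Qi_exponent1 : Qi_exponent 1.
Proof. by exists 1%g; rewrite ?group1 // gal_id expr1. Qed.

Lemma Qi_exponentM a b : Qi_exponent a -> Qi_exponent b -> Qi_exponent (a * b).
Proof.
move=> [tau Ktau tau_w] [rho Krho rho_w]; exists (tau * rho)%g.
  exact: groupM.
by rewrite galM ?memvf // tau_w rmorphXn /= rho_w -exprM mulnC.
Qed.

Lemma Qi_exponent_coprime a : Qi_exponent a -> coprime a n.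
Proof.
move=> [tau _ tau_w]; rewrite -(prim_root_exp_coprime a prim_w) -tau_w.
by rewrite fmorph_primitive_root.
Qed.

Lemma mem_QiP (x : cycL n) :
  reflect (forall tau, tau \in 'Gal({:cycL n} / Qi n)%g -> tau x = x) (x \in Qi n).
Proof.
have /galois_fixedField {2}<- := ratExt_galois (Qi n).
exact: fixedFieldP (memvf x).
Qed.

(** The order g = n / p of zeta_g exceeds 1, so the exponents of sigma form a
single class modulo g, which has a representative in 'I_g prime to g: the
default value of [galexp] does not occur. *)
Lemma galexp_mod (p a : nat) (sigma : gal_of (Qzeta n (n %/ p))) :
    (p %| n)%N -> (p < n)%N ->
    sigma (toL n (zeta (n %/ p))) = toL n (zeta (n %/ p)) ^+ a ->
  galexp sigma = a %[mod n %/ p].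
Proof.
move=> p_dv ltpn; have p_gt0 := dvdn_gt0 n_gt0 p_dv.
set g := (n %/ p)%N in sigma *; set z := toL n (zeta g) => sigma_z.
have g_gt1: (1 < g)%N by rewrite ltn_divRL ?mul1n.
have prim_z : g.-primitive_root z by rewrite toL_zeta_prim // dvdn_div.
rewrite /galexp; case: pickP => [b /andP[_ /eqP sigma_b] | no_b] /=.
  by apply/eqP; rewrite -(eq_prim_root_expr prim_z) -sigma_z -sigma_b.
have /negP[] := negbT (no_b (Ordinal (ltn_pmod a (ltnW g_gt1)))) => /=.
rewrite coprime_modl (prim_expr_mod prim_z) sigma_z eqxx andbT.
by rewrite -(prim_root_exp_coprime a prim_z) -sigma_z fmorph_primitive_root.
Qed.

(** The exponent of tau on n-th roots of unity, reduced modulo g = n / p, is that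
of its restriction to Q(zeta_g), and every element of Gal(Q(zeta_g) / F) is such a
restriction. *)
Lemma galorbitP (p : nat) (x y : 'I_n) :
    (p %| n)%N -> (p < n)%N -> gcdn x n = p ->
  reflect (exists2 a, Qi_exponent a & val y = (a * x %% n)%N)
          (y \in galorbit n p x).
Proof.
move=> p_dv ltpn gcd_p; have p_gt0 := dvdn_gt0 n_gt0 p_dv.
have g_gt1: (1 < n %/ p)%N by rewrite ltn_divRL ?mul1n.
have g_dv := dvdn_div p_dv.
have prim_z := toL_zeta_prim g_gt1 g_dv.
have nE : normalField 1 (Qzeta n (n %/ p)) := prim_root_normal prim_z.
have Ez : toL n (zeta (n %/ p)) \in Qzeta n (n %/ p) := memv_adjoin _ _.
have zw a (tau : gal_of {:cycL n}) : tau w = w ^+ a ->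
    tau (toL n (zeta (n %/ p))) = toL n (zeta (n %/ p)) ^+ a.
  move=> tau_w; have [|i ->] := prim_rootP prim_w (x := toL n (zeta (n %/ p))).
    by apply/eqP; rewrite -(prim_order_dvd prim_z).
  by rewrite rmorphXn /= tau_w -!exprM mulnC.
have galactE a (sigma : gal_of (Qzeta n (n %/ p))) :
    galexp sigma = a %[mod n %/ p] -> galact sigma x = (a * x %% n)%N.
  move=> Da; rewrite /galact -modnMml Da modnMml muln_modr mulnCA.
  have p_dv_x : (p %| x)%N by rewrite -gcd_p dvdn_gcdl.
  by rewrite [(p * (x %/ p))%N]mulnC [(p * (n %/ p))%N]mulnC !divnK.
(* Q(zeta_g) is contained in Q(zeta_n). *)
have FE : (fieldF n :&: Qzeta n (n %/ p) = Qi n :&: Qzeta n (n %/ p))%VS.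
  rewrite -capvA; congr (_ :&: _)%VS.
  apply/capv_idPr; rewrite sub_adjoin1v.
  have [|i ->] := prim_rootP prim_w (x := toL n (zeta (n %/ p))).
    by apply/eqP; rewrite -(prim_order_dvd prim_z).
  by rewrite rpredX // memv_adjoin.
rewrite inE; apply: (iffP exists_inP) => [[sigma] | [a [tau Ktau tau_w] Dy]].
  rewrite /galG FE => /(gal_extend (ratExt_galois _) nE)[tau Ktau st] /eqP->.
  have [a a_exp tau_w] := Qi_exponent_gal Ktau.
  exists a => //; apply: galactE; apply: galexp_mod => //.
  by rewrite st // (zw a).
have [sigma Ksigma st] := gal_restrict nE Ktau.
exists sigma; first by rewrite /galG FE.
by rewrite Dy (galactE a) //; apply: galexp_mod => //; rewrite st // (zw a).
Qed.

(** An automorphism with exponent a sends the r-th eigenvalue of S to that of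
a S; a S is contained in S exactly when it equals S, as multiplication by a is
injective. *)
Lemma gauss_integral_stableP (S : {set 'I_n}) :
  gauss_integral S <->
  forall a (s y : 'I_n),
    Qi_exponent a -> s \in S -> val y = (a * s %% n)%N -> y \in S.
Proof.
pose mulo a (s : 'I_n) := Ordinal (ltn_pmod (a * s) n_gt0).
have mulo_inj a : Qi_exponent a -> injective (mulo a).
  move=> /Qi_exponent_coprime co_a s1 s2 /(congr1 val)/= eq_as; apply/val_inj.
  suff: s1 = s2 %[mod n] by rewrite !modn_small.
  have prim_wa : n.-primitive_root (w ^+ a) by rewrite prim_root_exp_coprime.
  apply/eqP; rewrite -(eq_prim_root_expr prim_wa) -!exprM.
  by rewrite (eq_prim_root_expr prim_w) eq_as.
pose l (r : 'I_n) : cycL n := \sum_(s in S) w ^+ (r * s).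
have gal_l a (tau : gal_of {:cycL n}) r : Qi_exponent a -> tau w = w ^+ a ->
    tau (l r) = \sum_(s in mulo a @: S) w ^+ (r * s).
  move=> a_exp tau_w; rewrite big_imset /=; last by move=> ? ? _ _ /mulo_inj->.
  rewrite /l rmorph_sum; apply: eq_bigr => s _ /=.
  rewrite rmorphXn /= tau_w -exprM mulnCA !(mulnC r) exprM [RHS]exprM.
  by rewrite (prim_expr_mod prim_w).
have -> : gauss_integral S <-> forall r, l r \in Qi n.
  have prim_z : n.-primitive_root (zeta n) := zeta_prim n_gt1.
  apply: (iff_trans (gauss_integralP _ prim_z)).
  suff Dl r : (l r \in Qi n) =
      (\sum_(s in S) zeta n ^+ (r * s) \in Crat_span [:: 1; 'i]).
    by split=> lP r; have := lP r; rewrite Dl.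
  rewrite (mem_adjoin_i _ cycC_i).
  suff -> : cycC n (l r) = \sum_(s in S) zeta n ^+ (r * s) by [].
  by rewrite /l rmorph_sum; apply: eq_bigr => s _; rewrite rmorphXn /= cycC_zeta.
split=> [Ql a s y [tau Ktau tau_w] Ss Dy | stS r].
  have a_exp : Qi_exponent a by exists tau.
  (* The difference of the indicators of S and a S has zero transform. *)
  pose f s : cycL n := (s \in S)%:R - (s \in mulo a @: S)%:R.
  suff /(_ y) : forall s, f s = 0.
    rewrite /f; have -> : y = mulo a s by apply/val_inj.
    by rewrite imset_f //; case: (_ \in S) => // /eqP; rewrite sub0r oppr_eq0 oner_eq0.
  apply: (fourier_inj prim_w) => r.
  under eq_bigr => i _ do rewrite mulrBl.
  rewrite sumrB; apply/eqP; rewrite subr_eq0; apply/eqP.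
  have indE (A : {set 'I_n}) :
      \sum_i (i \in A)%:R * w ^+ (r * i) = \sum_(i in A) w ^+ (r * i).
    rewrite [RHS]big_mkcond; apply: eq_bigr => i _.
    by case: (i \in A); rewrite ?mul1r ?mul0r.
  by rewrite !indE -(gal_l a tau) // (mem_QiP _ (Ql r)).
apply/mem_QiP=> tau Ktau; have [a a_exp tau_w] := Qi_exponent_gal Ktau.
rewrite (gal_l a) //; suff -> : mulo a @: S = S by [].
apply/eqP; rewrite eqEcard card_imset ?leqnn ?andbT; last exact: mulo_inj.
by apply/subsetP=> _ /imsetP[s Ss ->]; apply: (stS a s).
Qed.

End Partition.

Theorem mainTheorem3 (n t k : nat) (ht : 2 < t) (hk : 1 <= k)
    (hn : n = 2 ^ t * k) (S : {set 'I_n}) (hS : forall s, s \in S -> 0 < s) :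
  gauss_integral S <->
  exists B : {set {set 'I_n}}, B \subset Mset n /\ S = cover B.
Proof.
have n_gt1 : 1 < n.
  rewrite hn (leq_trans _ (leq_pmulr _ hk)) // -[2]/(2 ^ 1).
  by rewrite leq_exp2l // ltnW // ltnW.
apply: (iff_trans (gauss_integral_stableP n_gt1 S)); split=> [stS | [B [sBM ->]]].
  exists [set M in Mset n | M \subset S]; split.
    by apply/subsetP=> M; rewrite inE => /andP[].
  apply/setP=> s; apply/idP/bigcupP => [Ss | [M]]; last first.
    by rewrite inE => /andP[_ /subsetP sMS] /sMS.
  have ltpn : gcdn s n < n.
    by apply: leq_ltn_trans (ltn_ord s); rewrite dvdn_leq ?hS // dvdn_gcdl.
  have p_dv := dvdn_gcdr s n.
  exists (galorbit n (gcdn s n) s).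
    rewrite inE; apply/andP; split.
      by apply/imset2P; exists (Ordinal ltpn) s; rewrite ?inE /= ?p_dv ?hS ?eqxx.
    apply/subsetP=> y /(galorbitP n_gt1 _ p_dv ltpn erefl)[a a_exp Dy].
    exact: stS a_exp Ss Dy.
  apply/(galorbitP n_gt1 _ p_dv ltpn erefl); exists 1.
    exact: Qi_exponent1.
  by rewrite mul1n modn_small.
move=> a s y a_exp /bigcupP[M BM Ms] Dy; apply/bigcupP; exists M => //.
have /imset2P[p x] := subsetP sBM M BM; rewrite !inE => p_dv /andP[_ /eqP gcd_x] DM.
move: Ms; rewrite DM => /(galorbitP n_gt1 _ p_dv (ltn_ord p) gcd_x)[b b_exp Ds].
apply/(galorbitP n_gt1 _ p_dv (ltn_ord p) gcd_x); exists (a * b).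
  exact: Qi_exponentM.
by rewrite Dy Ds modnMmr mulnA.
Qed.
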